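(* Let $p\in[1,\infty)$. There exists a constant $\kappa\in(0,\infty)$, which depends only on $p$, such that the following holds. Let $(\Omega,\mathcal{F},P)$ be a probability space endowed with a filtration $(\mathcal{F}_n)_{n\in\mathbb{N}_0}$, let $\|\cdot\|$ be a Hilbert space norm on $\mathbb{R}^d$, and let $(\zeta_n)_{n\in\mathbb{N}_0}$ be an adapted $d$-dimensional process for which there exist a previsible $d$-dimensional process $(\xi_n)_{n\in\mathbb{N}}$, a $d$-dimensional martingale $(M_n)_{n\in\mathbb{N}_0}$ with $M_0=\zeta_0$ and a constant $c\ge0$ such that for all $n\in\mathbb{N}$ \[ \zeta_n=\xi_n+\Delta M_n\qquad\text{and}\qquad \|\xi_n\|\le\|\zeta_{n-1}\|\vee c . \] Then for every $n\in\mathbb{N}_0$ \[ \mathbb{E}\Bigl[\max_{0\le k\le n}\|\zeta_k\|^p\Bigr]\le\kappa\,\bigl(\mathbb{E}\bigl[[M]_n^{p/2}\bigr]+c^p\bigr). \]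
   Context: Here $\Delta M_n=M_n-M_{n-1}$, $[M]_n=\sum_{k=1}^n\|\Delta M_k\|^2+\|M_0\|^2$, and $a\vee b=\max(a,b)$. A Hilbert space norm on $\mathbb{R}^d$ is a norm induced by a scalar product. Previsible means that $\xi_n$ is $\mathcal{F}_{n-1}$-measurable for every $n\in\mathbb{N}$. *)

(* Defs.v *)
From HB Require Import structures.
From mathcomp Require Import all_boot all_order all_algebra.
From mathcomp Require Import all_classical all_reals all_analysis.

Set Implicit Arguments.
Unset Strict Implicit.
Unset Printing Implicit Defensive.

Import Order.TTheory GRing.Theory Num.Theory.
Import numFieldNormedType.Exports.

Local Open Scope classical_set_scope.
Local Open Scope ring_scope.

Definition is_hilbert_norm (R : realType) (d : nat) (N : 'rV[R]_d -> R) : Prop :=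
  exists B : {dot 'rV[R]_d for idfun}, forall x, N x = Num.sqrt (B x x).

Section processes.
Context (disp : measure_display) (T : measurableType disp) (R : realType).
Implicit Types (P : probability T R) (G : set (set T)) (F : nat -> set (set T)).

Definition is_filtration F : Prop :=
  [/\ forall n, sigma_algebra setT (F n),
      forall n, F n `<=` measurable
    & forall m n, (m <= n)%N -> F m `<=` F n].

(* When G is a sigma-algebra, the measurable sets of g_sigma_algebraType G
   are exactly the elements of G. *)
Definition measurable_wrt G (X : T -> R) : Prop :=
  measurable_fun [set: g_sigma_algebraType G]
    (X : g_sigma_algebraType G -> R).

(* The Borel sigma-algebra of R^d is generated by the coordinate maps. *)
Definition vmeasurable_wrt (d : nat) G (X : T -> 'rV[R]_d) : Prop :=
  forall i, measurable_wrt G (fun w => X w ord0 i).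

Definition adapted (d : nat) F (X : nat -> T -> 'rV[R]_d) : Prop :=
  forall n, vmeasurable_wrt (F n) (X n).

(* The process is indexed by n >= 1; the value X 0 is irrelevant. *)
Definition previsible (d : nat) F (X : nat -> T -> 'rV[R]_d) : Prop :=
  forall n, vmeasurable_wrt (F n) (X n.+1).

(* Y is a version of the conditional expectation E[X | G]. *)
Definition is_cond_exp P G (X Y : T -> R) : Prop :=
  [/\ measurable_wrt G Y,
      P.-integrable setT (EFin \o Y)
    & forall A, G A ->
        (\int[P]_(w in A) (Y w)%:E = \int[P]_(w in A) (X w)%:E)%E].

Definition martingale (d : nat) P F (M : nat -> T -> 'rV[R]_d) : Prop :=
  [/\ adapted F M,
      forall n i, P.-integrable setT (fun w => (M n w ord0 i)%:E)
    & forall n i, is_cond_exp P (F n)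
        (fun w => M n.+1 w ord0 i) (fun w => M n w ord0 i)].

Definition quadvar (d : nat) (N : 'rV[R]_d -> R) (M : nat -> T -> 'rV[R]_d)
    (n : nat) (w : T) : R :=
  \sum_(1 <= k < n.+1) N (M k w - M k.-1 w) ^+ 2 + N (M 0%N w) ^+ 2.

End processes.

(* Main.v *)
(** Let [S_k] be the running maximum of [c] and of the norms of [zeta], and [r]
    the square root of [[M]]. For fixed [k], the distance [D_j] of [zeta_j] to
    the ball of radius [S_k >= c] does not increase along the drift
    ([|xi_{j+1}| <= max(|zeta_j|, c)]), so that
    [D_{j+1}^2 <= D_j^2 + 2 <q, dM> + |dM|^2] for a previsible [q] with
    [|q| <= D_j]. A pathwise Davis inequality in the style of Beiglboeck and
    Siorpaes, with integrand [q / (r_j + S_j - S_k)], then yields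
    [S_n - S_k <= 53 r_n + 8 (martingale transform started at k)]. Summing
    these estimates against [S_k^(p-1) - S_{k-1}^(p-1)] (Garsia's argument,
    carried out pathwise) gives [S_n^p <= const (r_n^p + c^p)] plus a martingale
    transform, which is integrable as soon as [r_n^p] is, and centered. *)

Require Import Defs.
From HB Require Import structures.
From mathcomp Require Import all_boot all_order all_algebra.
From mathcomp Require Import all_classical all_reals all_analysis.
From mathcomp Require Import measurable_realfun ring lra.

Set Implicit Arguments.
Unset Strict Implicit.
Unset Printing Implicit Defensive.

Import Order.TTheory GRing.Theory Num.Theory.
Import numFieldNormedType.Exports.

Local Open Scope classical_set_scope.
Local Open Scope ring_scope.

(** * Deterministic inequalities *)

(** The potential [D^2/(r+S) + max(S-r,0)/4] is designed so that, when a small increment raises [S],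
    the larger denominator lowers the first term by enough to pay for the second. What is left over
    is the transform increment [2b/(r+S)] and a multiple of [r' - r]. *)
Lemma lyapunov_step (R : realFieldType) (D D' a b r r' S S' : R) :
  0 <= D -> D <= S -> 0 <= D' -> 0 <= a -> 0 <= r -> 0 <= r' ->
  r' ^+ 2 = r ^+ 2 + a ^+ 2 -> S' = Num.max S D' ->
  D' ^+ 2 <= D ^+ 2 + 2 * b + a ^+ 2 -> `|b| <= D * a ->
  D' ^+ 2 / (r' + S') + 4^-1 * Num.max (S' - r') 0 <=
  D ^+ 2 / (r + S) + 4^-1 * Num.max (S - r) 0 + 2 * (b / (r + S))
    + 13 * (r' - r).
Proof.
move=> D0 DS D'0 a0 r0 r'0 Er ES HD; rewrite ler_norml => /andP[bl bu].
have S0 : 0 <= S by exact: le_trans DS.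
have D'S' : D' <= S' by rewrite ES le_max lexx orbT.
have SS' : S <= S' by rewrite ES le_max lexx.
have S'Da : S' <= S + a.
  have D'a : D' <= D + a by rewrite -(@ler_pXn2r _ 2) ?nnegrE ?addr_ge0//; nra.
  by rewrite ES ge_max; apply/andP; split; lra.
have rr' : r <= r' by rewrite -(@ler_pXn2r _ 2) ?nnegrE// Er; nra.
have ra' : a <= r' by rewrite -(@ler_pXn2r _ 2) ?nnegrE// Er; nra.
have x0 : 0 <= Num.max (S - r) 0 by rewrite le_max lexx orbT.
have xS : S - r <= Num.max (S - r) 0 by rewrite le_max lexx.
have HD' : D' <= D + a by rewrite -(@ler_pXn2r _ 2) ?nnegrE ?addr_ge0//; nra.
have yx : Num.max (S' - r') 0 <= Num.max (S - r) 0 + a.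
  by rewrite ge_max; apply/andP; split; lra.
have U0 : 0 <= r + S by rewrite addr_ge0.
(* Degenerate case [r + S = 0]: as the inverse of [0] is [0], the old potential and the transform
   term vanish, and [r' = a] bounds the new potential. *)
have := U0; rewrite le_eqVlt => /predU1P[UE|Up].
  have [rE SE] : r = 0 /\ S = 0 by split; lra.
  have DE : D = 0 by lra.
  have r'a : r' = a.
    apply/eqP; rewrite -(@eqrXn2 _ 2)// Er rE; apply/eqP; ring.
  have y0 : Num.max (S' - r') 0 = 0.
    by apply/max_idPr; rewrite r'a; lra.
  have D2 : D' ^+ 2 / (r' + S') <= a.
    have [->|U'] := eqVneq (r' + S') 0; first by rewrite invr0 mulr0.
    rewrite ler_pdivrMr; last by rewrite lt_def U'/= addr_ge0//; lra.
    by nra.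
  by rewrite y0 -UE invr0 !mulr0; lra.
have U'p : 0 < r' + S' by lra.
(* Large increment [r <= a]: then [a <= 3 (r' - r)], and crude bounds suffice: [2a] for the
   quotient, [2a] for the transform term and [a/4] for the maximum, with [3 * 17/4 <= 13]. *)
have [ar|ra] := leP r a.
  have a3 : a <= 3 * (r' - r).
    have r'2a : r' <= 2 * a by rewrite -(@ler_pXn2r _ 2) ?nnegrE ?mulr_ge0// Er; nra.
    have [->|an0] := eqVneq a 0; first by lra.
    have a_gt0 : 0 < a by rewrite lt_def an0.
    by rewrite -(ler_pM2l a_gt0); nra.
  have b2 : - a <= b / (r + S) by rewrite ler_pdivlMr//; nra.
  have D2 : D' ^+ 2 / (r' + S') <= D ^+ 2 / (r + S) + 2 * a.
    have : D ^+ 2 / (r' + S') <= D ^+ 2 / (r + S).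
      by rewrite ler_wpM2l ?sqr_ge0// lef_pV2 ?posrE//; lra.
    suff : D' ^+ 2 / (r' + S') <= D ^+ 2 / (r' + S') + 2 * a by lra.
    rewrite ler_pdivrMr// mulrDl divfK ?gt_eqF//.
    have h1 : 0 <= (D + a - D') * (D' + D) by rewrite mulr_ge0//; lra.
    have h2 : 0 <= a * (2 * (r' + S') - (D' + D)) by rewrite mulr_ge0//; lra.
    by lra.
  by lra.
(* Small increment [a < r]: [a^2/(r+S)] is at most [3 (r' - r)], so the growth of the maximum must
   be paid by the change of denominator under [D'^2]. *)
have rp : 0 < r by lra.
have a2 : a ^+ 2 / (r + S) <= 3 * (r' - r).
  have r'2r : r' <= 2 * r by rewrite -(@ler_pXn2r _ 2) ?nnegrE ?mulr_ge0// Er; nra.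
  rewrite ler_pdivrMr//.
  have h : 0 <= (r' - r) * (3 * (r + S) - (r' + r)) by rewrite mulr_ge0//; lra.
  by lra.
set y := Num.max (S' - r') 0.
have E1 : D' ^+ 2 / (r + S) <= D ^+ 2 / (r + S) + 2 * (b / (r + S)) + a ^+ 2 / (r + S).
  by rewrite mulrA -!mulrDl ler_pM2r ?invr_gt0.
suff : 4^-1 * (y - Num.max (S - r) 0) <= D' ^+ 2 / (r + S) - D' ^+ 2 / (r' + S').
  by lra.
have E0 : 0 <= D' ^+ 2 / (r + S) - D' ^+ 2 / (r' + S').
  by rewrite subr_ge0 ler_wpM2l ?sqr_ge0// lef_pV2 ?posrE//; lra.
have [S'r'|r'S'] := leP (S' - r') 0.
  by have -> : y = 0; [exact/max_idPr|lra].
have yE : y = S' - r' by apply/max_idPl; exact: ltW.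
have [S'S|D'S] := leP D' S.
  have : S' = S by rewrite ES; exact/max_idPl.
  by lra.
have S'D' : S' = D' by rewrite ES; apply/max_idPr; exact: ltW.
(* At a new maximum [S' = D' > r'], both denominators are at most [2 D']; this is the origin of the
   weight [1/4]. *)
apply: (@le_trans _ _ (4^-1 * ((r' + S') - (r + S)))); first by lra.
have -> : D' ^+ 2 / (r + S) - D' ^+ 2 / (r' + S') =
   (D' ^+ 2 * ((r' + S') - (r + S))) / ((r + S) * (r' + S')).
  by field; rewrite !gt_eqF.
rewrite ler_pdivlMr ?mulr_gt0//.
rewrite mulrAC ler_wpM2r//; first by lra.
by nra.
Qed.

Lemma running_max_bound (R : realFieldType) (D a b r S : nat -> R) (k n : nat) :
  (k <= n)%N -> D k = 0 -> S k = 0 ->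
  (forall j, 0 <= D j) -> (forall j, 0 <= a j) -> (forall j, 0 <= r j) ->
  (forall j, (k <= j < n)%N ->
    [/\ r j.+1 ^+ 2 = r j ^+ 2 + a j ^+ 2, S j.+1 = Num.max (S j) (D j.+1),
        D j.+1 ^+ 2 <= D j ^+ 2 + 2 * b j + a j ^+ 2 & `|b j| <= D j * a j]) ->
  S n <= 53 * r n + 8 * \sum_(k <= j < n) b j / (r j + S j).
Proof.
move=> kn Dk Sk D0 a0 r0 H.
pose Psi j := D j ^+ 2 / (r j + S j) + 4^-1 * Num.max (S j - r j) 0.
(* [Psi] vanishes at time [k], and [S n - r n <= 4 * Psi n]; hence [53 = 1 + 4 * 13] and
   [8 = 4 * 2]. *)
suff [DS Hn] : D n <= S n /\ Psi n <= 13 * (r n - r k)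
    + 2 * \sum_(k <= j < n) b j / (r j + S j).
  have : 0 <= D n ^+ 2 / (r n + S n).
    by rewrite divr_ge0 ?sqr_ge0// addr_ge0// (le_trans _ DS).
  have : S n - r n <= Num.max (S n - r n) 0 by rewrite le_max lexx.
  by have := r0 k; move: Hn; rewrite /Psi; lra.
elim: n kn H => [|n IH].
  rewrite leqn0 => /eqP E _; rewrite -E big_geq// /Psi Dk Sk.
  by split; rewrite // expr0n mul0r; have := r0 k; case: (leP (0 - r k) 0); lra.
rewrite leq_eqVlt => /predU1P[E _|kn H].
  rewrite -E big_geq// /Psi Dk Sk.
  by split; rewrite // expr0n mul0r; have := r0 k; case: (leP (0 - r k) 0); lra.
have [|DS Hn] := IH kn.
  by move=> j /andP[kj jn]; apply: H; rewrite kj ltnS ltnW.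
have [|Er ES HD Hb] := H n; first by rewrite -ltnS kn ltnSn.
split; first by rewrite ES le_max lexx orbT.
rewrite big_nat_recr//=.
have := lyapunov_step (D0 n) DS (D0 n.+1) (a0 n) (r0 n) (r0 n.+1) Er ES HD Hb.
by move: Hn; rewrite /Psi; lra.
Qed.

(** Convexity of the power, derived from Young's inequality with exponents [p/(p-1)] and [p]; the
    case [p = 1], where the first one degenerates, is treated apart. *)
Lemma powRB_le (R : realType) (p x y : R) : 1 <= p -> 0 <= y -> y <= x ->
  x `^ p - y `^ p <= p * (x `^ (p - 1) * (x - y)).
Proof.
move=> p1 y0 yx; have x0 : 0 <= x by exact: le_trans yx.
have p0 : 0 < p by lra.
rewrite mulrBr mulrC -(mulrC x) mulr_powRB1//.
have [->|pn1] := eqVneq p 1; first by rewrite subrr !powRr1// powRr0; lra.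
have pm1 : 0 < p - 1 by rewrite subr_gt0 lt_def pn1.
suff : x `^ (p - 1) * y <= x `^ p / (p / (p - 1)) + y `^ p / p.
  have -> : x `^ p / (p / (p - 1)) + y `^ p / p = ((p - 1) * x `^ p + y `^ p) / p.
    by field; rewrite !gt_eqF//; apply/andP.
  by rewrite ler_pdivlMr//; lra.
have -> : x `^ p = (x `^ (p - 1)) `^ (p / (p - 1)).
  by rewrite -powRrM mulrC divfK// gt_eqF.
apply: conjugate_powR => //; first exact: powR_ge0.
  by rewrite divr_gt0.
by field; rewrite !gt_eqF.
Qed.

(** Either [y] is at most half of [x], or [x] is below [2y]. The coefficient [1/2] allows the power
    of [x] to be absorbed into a left-hand side. *)
Lemma mul_powR_absorb (R : realType) (p x y : R) : 1 <= p -> 0 <= x -> 0 <= y ->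
  x `^ (p - 1) * y <= 2^-1 * x `^ p + (2 * y) `^ p.
Proof.
move=> p1 x0 y0; have p0 : 0 < p by lra.
have [xy|yx] := leP (2 * y) x.
  have := powR_ge0 (2 * y) p; have := powR_ge0 x (p - 1).
  by rewrite -(mulr_powRB1 x0 p0); nra.
have y20 : 0 <= 2 * y by rewrite mulr_ge0.
apply: (@le_trans _ _ ((2 * y) `^ p)).
  rewrite -(mulr_powRB1 y20 p0) mulrC ler_pM ?powR_ge0//; first by lra.
  by rewrite ge0_ler_powR ?nnegrE ?subr_ge0// ltW.
by rewrite lerDr mulr_ge0// powR_ge0.
Qed.

(** The value before time [0] counts as [0], so that the increments up to time [k] add up to the
    [q]-th power of [S k]. *)
Definition powR_incr (R : realType) (q : R) (S : nat -> R) (k : nat) : R :=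
  if k is j.+1 then S j.+1 `^ q - S j `^ q else S 0%N `^ q.

Lemma powR_incr_ge0 (R : realType) (q : R) (S : nat -> R) (k : nat) :
  0 <= q -> 0 <= S 0%N -> {homo S : i j / (i <= j)%N >-> i <= j} ->
  0 <= powR_incr q S k.
Proof.
move=> q0 S0 ndS; have Sn0 j : 0 <= S j by exact: le_trans (ndS 0%N j _).
case: k => [|k] /=; first exact: powR_ge0.
by rewrite subr_ge0 ge0_ler_powR ?nnegrE// ndS.
Qed.

(* A deterministic form of the Garsia-Neveu lemma. *)
Lemma garsia_bound (R : realType) (p r c A : R) (S m : nat -> R) (n : nat) :
  1 <= p -> 0 <= r -> 0 <= c -> 0 <= A ->
  0 <= S 0%N -> S 0%N <= c + r -> {homo S : i j / (i <= j)%N >-> i <= j} ->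
  (forall k, (k < n)%N -> S k.+1 <= S k + r) ->
  (forall k, (k <= n)%N -> S n - S k <= A * r + m k) ->
  S n `^ p <= 2 * (2 * (p * ((A + 1) * r + c))) `^ p
            + 2 * p * \sum_(k < n.+1) powR_incr (p - 1) S k * m k.
Proof.
move=> p1 r0 c0 A0 S0 Sc ndS Sr Sm.
have p0 : 0 < p by lra.
have q0 : 0 <= p - 1 by lra.
have Sn0 j : 0 <= S j by exact: le_trans (ndS 0%N j _).
set y := (A + 1) * r + c.
have y0 : 0 <= y by rewrite /y; nra.
(* Summation by parts as an induction. By convexity, passing from [i] to [i+1] raises the left side
   by at most the increment of the [(p-1)]-th power times [S n - S i], and this difference is at
   most [y + m i.+1], the jump [S i.+1 - S i] costing one extra [r]. *)
have H i : (i <= n)%N -> p^-1 * S i `^ p + S i `^ (p - 1) * (S n - S i) <=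
    S i `^ (p - 1) * y + \sum_(k < i.+1) powR_incr (p - 1) S k * m k.
  elim: i => [_|i IH lt_in].
    rewrite big_ord1/= -{1}(mulr_powRB1 (Sn0 0%N) p0).
    have f0 : 0 <= S 0%N `^ (p - 1) by exact: powR_ge0.
    have pV : p^-1 * (S 0%N * S 0%N `^ (p - 1)) <= S 0%N * S 0%N `^ (p - 1).
      by rewrite ler_piMl ?mulr_ge0// invf_le1.
    have h : 0 <= S 0%N `^ (p - 1) * (y + m 0%N - (S n - S 0%N) - S 0%N).
      by rewrite mulr_ge0// /y; have := Sm 0%N (leq0n _); lra.
    by lra.
  have {}IH := IH (ltnW lt_in).
  rewrite big_ord_recr /= -/(powR_incr (p - 1) S i.+1).
  have w0 := powR_incr_ge0 i.+1 q0 S0 ndS.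
  have wE : S i.+1 `^ (p - 1) = S i `^ (p - 1) + powR_incr (p - 1) S i.+1.
    by rewrite /=; ring.
  have Sp := powRB_le p1 (Sn0 i) (ndS _ _ (leqnSn i)).
  have {}Sp : p^-1 * S i.+1 `^ p - p^-1 * S i `^ p <= S i.+1 `^ (p - 1) * (S i.+1 - S i).
    by rewrite -mulrBr mulrC ler_pdivrMr// mulrC.
  have h : 0 <= powR_incr (p - 1) S i.+1 * (y + m i.+1 - (S n - S i)).
    rewrite mulr_ge0// /y; have := Sm _ lt_in; have := Sr _ lt_in; lra.
  move: (powR_incr _ _ _) wE w0 h Sp => w -> w0 h Sp.
  by lra.
have := H _ (leqnn n); rewrite subrr mulr0 addr0.
set Z := \sum_(_ < _) _ => Hn.
(* Half of the [p]-th power of [S n] is absorbed on the left, whence the factors [2]. *)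
have := mul_powR_absorb p1 (Sn0 n) (mulr_ge0 (ltW p0) y0).
move: Hn; rewrite mulrC ler_pdivrMr// => Hn.
rewrite -/y; lra.
Qed.

(** * Inner products *)

Section dot.
Context (R : realType) (U : lmodType R) (B : {dot U for idfun}).
Implicit Types (x y : U) (a : R).

Lemma dotC x y : B x y = B y x.
Proof. by rewrite (hermC B x y) expr0 mul1r. Qed.

Lemma dot0l y : B 0 y = 0.
Proof. exact: linear0l. Qed.

Lemma dotDl x y z : B (x + y) z = B x z + B y z.
Proof. exact: linearDl. Qed.

Lemma dotZl a x y : B (a *: x) y = a * B x y.
Proof. exact: linearZl_LR. Qed.

Lemma dot_ge0 x : 0 <= B x x.
Proof.
have [->|x0] := eqVneq x 0; first by rewrite dot0l.
by rewrite ltW// neq0_dnorm_gt0.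
Qed.

Lemma dotDD x y : B (x + y) (x + y) = B x x + 2 * B x y + B y y.
Proof.
by rewrite dotDl (dotC x (x + y)) (dotC y (x + y)) !dotDl (dotC y x); ring.
Qed.

Lemma dotZZ a x : B (a *: x) (a *: x) = a ^+ 2 * B x x.
Proof. by rewrite dotZl (dotC x) dotZl; ring. Qed.

Let N x : R := Num.sqrt (B x x).

(** Cauchy-Schwarz: the squared norm of [y] minus its projection on [x] is nonnegative. *)
Lemma dot_normr_le x y : `|B x y| <= N x * N y.
Proof.
rewrite -(@ler_pXn2r _ 2) ?nnegrE ?mulr_ge0 ?sqrtr_ge0//.
rewrite exprMn !sqr_sqrtr ?dot_ge0// real_normK ?num_real//.
have [->|x0] := eqVneq x 0; first by rewrite !dot0l expr0n mul0r.
have xp : 0 < B x x by rewrite neq0_dnorm_gt0.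
have := dot_ge0 ((- (B x y / B x x)) *: x + y).
rewrite dotDD dotZZ dotZl.
have -> : (- (B x y / B x x)) ^+ 2 * B x x + 2 * (- (B x y / B x x) * B x y) + B y y
  = B y y - B x y ^+ 2 / B x x by field; rewrite gt_eqF.
by rewrite subr_ge0 ler_pdivrMr// mulrC.
Qed.

Lemma dot_norm_triangle x y : N (x + y) <= N x + N y.
Proof.
rewrite -(@ler_pXn2r _ 2) ?nnegrE ?addr_ge0 ?sqrtr_ge0//.
rewrite sqrrD !sqr_sqrtr ?dot_ge0// dotDD.
by have := ler_normlW (dot_normr_le x y); rewrite -mulr_natl; lra.
Qed.

Lemma dot_normZ a x : N (a *: x) = `|a| * N x.
Proof. by rewrite /N dotZZ sqrtrM ?sqr_ge0// sqrtr_sqr. Qed.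

(* With [lam := Num.max (N x - rho) 0 / N x], [lam *: x] is the difference of
   [x] and its projection on the ball of radius [rho], so that the left-hand
   side is at most [N (lam *: x + y) ^+ 2]. *)
Lemma dist_ball_sqr_le x y (rho : R) : 0 <= rho ->
  Num.max (N (x + y) - rho) 0 ^+ 2 <=
  Num.max (N x - rho) 0 ^+ 2 + 2 * (Num.max (N x - rho) 0 / N x * B x y) + N y ^+ 2.
Proof.
move=> rho0; set lam := Num.max (N x - rho) 0 / N x; set D := Num.max (N x - rho) 0.
have Nx0 : 0 <= N x by exact: sqrtr_ge0.
have D0 : 0 <= D by rewrite /D le_max lexx orbT.
have DN : D <= N x by rewrite /D ge_max Nx0 andbT; lra.
have DE : lam * N x = D.
  have [Nx|Nx] := eqVneq (N x) 0; last by rewrite divfK.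
  by rewrite Nx mulr0; lra.
have lam0 : 0 <= lam by rewrite divr_ge0.
have lam1 : lam <= 1.
  have [Nx|Nx] := eqVneq (N x) 0; first by rewrite /lam Nx invr0 mulr0.
  by rewrite ler_pdivrMr ?mul1r// lt_def Nx.
have E : N (lam *: x + y) ^+ 2 = D ^+ 2 + 2 * (lam * B x y) + N y ^+ 2.
  rewrite -DE exprMn !sqr_sqrtr ?dot_ge0// dotDD dotZZ dotZl; ring.
rewrite -E ler_pXn2r ?nnegrE ?sqrtr_ge0 ?le_max ?lexx ?orbT//.
rewrite ge_max sqrtr_ge0 andbT.
(* The vector [(1 - lam) *: x] is the projection of [x] on the ball, of norm [N x - D <= rho]; the
   triangle inequality concludes. *)
have -> : x + y = (lam *: x + y) + (1 - lam) *: x.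
  by rewrite scalerBl scale1r [RHS]addrC addrA subrK.
have := dot_norm_triangle (lam *: x + y) ((1 - lam) *: x).
rewrite dot_normZ ger0_norm ?subr_ge0// mulrBl mul1r DE.
have : N x - rho <= D by rewrite /D le_max lexx.
by lra.
Qed.

Lemma dist_ball_dot_le x y (rho : R) : 0 <= rho ->
  `|Num.max (N x - rho) 0 / N x * B x y| <= Num.max (N x - rho) 0 * N y.
Proof.
move=> rho0; have Nx0 : 0 <= N x by exact: sqrtr_ge0.
have D0 : 0 <= Num.max (N x - rho) 0 by rewrite le_max lexx orbT.
rewrite normrM ger0_norm ?divr_ge0// -mulrA ler_wpM2l//.
have [Nx|Nx] := eqVneq (N x) 0; first by rewrite Nx invr0 mul0r sqrtr_ge0.
by rewrite mulrC ler_pdivrMr ?lt_def ?Nx// mulrC dot_normr_le.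
Qed.

End dot.

(** * Inner products on row vectors in coordinates *)

Section dot_coordinates.
Context (R : realType) (d : nat) (B : {dot 'rV[R]_d for idfun}).
Implicit Types x y : 'rV[R]_d.

Lemma dot_sum x y :
  B x y = \sum_i \sum_j x ord0 i * (B (delta_mx 0 i) (delta_mx 0 j) * y ord0 j).
Proof.
rewrite {1}(row_sum_delta x) linear_sumlz; apply: eq_bigr => i _.
rewrite {1}(row_sum_delta y) linear_sumr; apply: eq_bigr => j _.
by rewrite linearZl_LR linearZr_LR/=; ring.
Qed.

(** Definiteness makes the Gram matrix [A] invertible, so the [i]-th coordinate of [x] is its inner
    product with the transpose of [A^-1 e_i], and Cauchy-Schwarz applies. This transfers norm bounds
    to the coordinates, in which the martingale property is stated. *)
Lemma dot_coord_le : exists K : R, 0 <= K /\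
  forall x i, `|x ord0 i| <= K * Num.sqrt (B x x).
Proof.
pose A := \matrix_(i, j) B (delta_mx 0 i) (delta_mx 0 j).
have BA x y : B x y = (x *m A *m y^T) 0 0.
  rewrite dot_sum mxE; under [RHS]eq_bigr do rewrite !mxE big_distrl/=.
  rewrite exchange_big/=; apply: eq_bigr => i _; apply: eq_bigr => j _.
  by rewrite !mxE mulrA.
have Au : A \in unitmx.
  rewrite -row_free_unit -kermx_eq0; apply/rowV0P => v /sub_kermxP vA.
  apply/eqP/negPn/negP => v0; have := @neq0_dnorm_gt0 _ _ _ B v v0.
  by rewrite BA vA mul0mx mxE ltxx.
have key x i : `|x ord0 i| <=
    Num.sqrt (B x x) *
    Num.sqrt (B (invmx A *m delta_mx i 0)^T (invmx A *m delta_mx i 0)^T).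
  apply: le_trans (dot_normr_le B _ _).
  by rewrite BA trmxK mulmxA mulmxK// -colE mxE.
exists (\sum_i Num.sqrt (B (invmx A *m delta_mx i 0)^T (invmx A *m delta_mx i 0)^T)).
split; first by apply: sumr_ge0 => i _; exact: sqrtr_ge0.
move=> x i; apply: (le_trans (key x i)); rewrite mulrC ler_wpM2r ?sqrtr_ge0//.
by rewrite (bigD1 i)//= lerDl sumr_ge0// => j _; exact: sqrtr_ge0.
Qed.

End dot_coordinates.

(** * Martingale increments *)

Section conditionally_centered.
Context (disp : measure_display) (T : measurableType disp) (R : realType)
  (P : probability T R) (G : set (set T)).
Hypotheses (sG : sigma_algebra setT G) (Gm : G `<=` measurable).
Implicit Types h D : T -> R.

Lemma measurable_g_sigmaW (A : set (g_sigma_algebraType G)) : measurable A -> G A.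
Proof. by rewrite -[X in _ -> X _](sigma_algebra_id sG). Qed.

Lemma measurable_wrtW h : measurable_wrt G h -> measurable_fun setT h.
Proof.
move=> mh _ Y mY; by apply: Gm; apply: measurable_g_sigmaW; exact: mh.
Qed.

Variable D : T -> R.
Hypotheses (iD : P.-integrable setT (EFin \o D))
  (D0 : forall A, G A -> (\int[P]_(w in A) (D w)%:E = 0)%E).

Import HBNNSimple.

(** A simple function is a finite combination of indicators of sets of [G], on each of which [D]
    integrates to [0]. *)
Lemma integral_nnsfunM_eq0 (phi : {nnsfun (g_sigma_algebraType G) >-> R}) :
  (\int[P]_w (phi w * D w)%:E = 0)%E.
Proof.
have GA y : G (phi @^-1` [set y]).
  by apply: measurable_g_sigmaW; exact: measurable_funPTI.
pose f y w := (\1_(phi @^-1` [set y]) w * D w)%:E.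
have fE y : f y = (EFin \o D) \_ (phi @^-1` [set y]).
  by apply/funext => w; rewrite /f /patch indicE; case: ifPn => _; rewrite ?mul1r ?mul0r.
have iA y : P.-integrable setT (f y).
  rewrite fE; apply/(integrable_mkcond _ (Gm (GA y))).1.
  by apply: integrableS iD => //; exact: Gm.
transitivity (\int[P]_w
    \sum_(y <- finmap.enum_fset (fset_set (range phi))) (y%:E * f y w))%E.
  apply: eq_integral => w _; rewrite fimfunE fsbig_finite//= big_distrl/= -sumEFin.
  by apply: eq_bigr => y _; rewrite -mulrA EFinM.
rewrite integral_sum//; last by move=> y; exact: integrableZl.
apply: big1 => y _; rewrite integralZl// fE -integral_mkcond.
by rewrite [X in (_ * X)%E]D0// mule0.
Qed.

(** Dominated convergence along simple functions increasing to [h], with dominating function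
    [|h D|]; thus only the product has to be integrable, not [h]. *)
Lemma integral_ge0M_eq0 h : (forall w, 0 <= h w) -> measurable_wrt G h ->
  P.-integrable setT (fun w => (h w * D w)%:E) ->
  (\int[P]_w (h w * D w)%:E = 0)%E.
Proof.
move=> h0 mh ihD.
have mh' := (measurable_EFinP [set: g_sigma_algebraType G] h).2 mh.
have mD : measurable_fun setT D by apply/measurable_EFinP; exact: measurable_int iD.
pose phi := nnsfun_approx measurableT mh'.
have phih n w : phi n w <= h w.
  by rewrite -lee_fin /phi nnsfun_approxE le_approx// => x _; rewrite lee_fin.
have [| | | | |_ _] := @dominated_convergence _ T R P setT measurableT
  (fun n w => (phi n w * D w)%:E) (fun w => (h w * D w)%:E) (fun w => `|h w * D w|%:E).
- move=> n; apply/measurable_EFinP; apply: measurable_funM => //.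
  by apply: measurable_wrtW; exact: measurable_funPT.
- exact: measurable_int ihD.
- apply: aeW => w _; under eq_fun do rewrite EFinM.
  rewrite EFinM; apply: cvgeZr => //.
  by apply: cvg_nnsfun_approx => // x _; rewrite lee_fin.
- exact: integrable_abse ihD.
- apply: aeW => w n _; rewrite lee_fin !normrM ler_wpM2r//.
  by rewrite !ger0_norm.
rewrite (_ : (fun n => _) = cst 0%E); last first.
  by apply/funext => n; exact: integral_nnsfunM_eq0.
by move=> H; apply/esym; apply: (cvg_unique _ (cvg_cst _) H).
Qed.

(** Split [h] into positive and negative parts; each is at most [|h|], so its product with [D] stays
    integrable. *)
Lemma integral_measurable_wrtM_eq0 h : measurable_wrt G h ->
  P.-integrable setT (fun w => (h w * D w)%:E) ->
  (\int[P]_w (h w * D w)%:E = 0)%E.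
Proof.
move=> mh ihD.
have mD : measurable_fun setT D by apply/measurable_EFinP; exact: measurable_int iD.
have aux k : (forall w, 0 <= k w <= `|h w|) -> measurable_wrt G k ->
    P.-integrable setT (fun w => (k w * D w)%:E) /\
    (\int[P]_w (k w * D w)%:E = 0)%E.
  move=> hk mk; have ik : P.-integrable setT (fun w => (k w * D w)%:E).
    apply: le_integrable ihD => //.
      by apply/measurable_EFinP; apply: measurable_funM => //; exact: measurable_wrtW.
    move=> w _; rewrite !abse_EFin lee_fin !normrM ler_wpM2r//.
    by have /andP[k0 kh] := hk w; rewrite (ger0_norm k0).
  by split=> //; apply: integral_ge0M_eq0 => // w; have /andP[] := hk w.
have [||ip Ip] := aux (fun w => Num.max (h w) 0).
- by move=> w; rewrite le_max lexx orbT ge_max ler_norm normr_ge0.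
- exact: measurable_maxr.
have [||iN IN] := aux (fun w => Num.max (- h w) 0).
- by move=> w; rewrite le_max lexx orbT ge_max -normrN ler_norm normr_ge0.
- by apply: measurable_maxr => //; exact: measurableT_comp.
transitivity (\int[P]_w ((Num.max (h w) 0 * D w)%:E - (Num.max (- h w) 0 * D w)%:E))%E.
  apply: eq_integral => w _; rewrite -EFinB -mulrBl; congr (_ * _)%:E.
  by case: (leP (h w) 0); case: (leP (- h w) 0); lra.
by rewrite integralB// Ip IN sube0.
Qed.

End conditionally_centered.

(** * The pathwise estimate *)

Fixpoint running_max (R : realType) (c : R) (x : nat -> R) (n : nat) : R :=
  if n is j.+1 then Num.max (running_max c x j) (x j.+1) else Num.max c (x 0%N).

Section running_max.
Context (R : realType) (c : R) (x : nat -> R).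
Let S := running_max c x.

Lemma running_max_nd : {homo S : i j / (i <= j)%N >-> i <= j}.
Proof.
apply: homo_leq => [//|? ? ?|i]; first exact: le_trans.
by rewrite /= le_max lexx.
Qed.

Lemma running_max_ge j : x j <= S j.
Proof. by case: j => [|j]; rewrite /= le_max lexx orbT. Qed.

Lemma running_max_gec j : c <= S j.
Proof.
by rewrite (le_trans _ (running_max_nd (leq0n j)))//= le_max lexx.
Qed.

End running_max.

Lemma powRD_le (R : realType) (p x y : R) : 0 <= p -> 0 <= x -> 0 <= y ->
  (x + y) `^ p <= (2 * x) `^ p + (2 * y) `^ p.
Proof.
move=> p0 x0 y0; have [xy|yx] := leP x y.
  apply: (@le_trans _ _ ((2 * y) `^ p)); last by rewrite lerDr powR_ge0.
  by rewrite ge0_ler_powR ?nnegrE ?addr_ge0 ?mulr_ge0//; rewrite mulr_natl mulr2n lerD2r.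
apply: (@le_trans _ _ ((2 * x) `^ p)); last by rewrite lerDl powR_ge0.
rewrite ge0_ler_powR ?nnegrE ?addr_ge0 ?mulr_ge0//.
by rewrite mulr_natl mulr2n lerD2l ltW.
Qed.

Section pathwise.
Context (R : realType) (U : lmodType R) (B : {dot U for idfun}).
Variables (p c : R) (zeta xi M : nat -> U) (r : nat -> R) (n : nat).
Hypotheses (p1 : 1 <= p) (c0 : 0 <= c).
Let N (x : U) : R := Num.sqrt (B x x).
Let S := running_max c (N \o zeta).
Hypotheses (zeta0 : M 0%N = zeta 0%N)
  (zetaS : forall j, (j < n)%N -> zeta j.+1 = xi j.+1 + (M j.+1 - M j))
  (xi_le : forall j, (j < n)%N -> N (xi j.+1) <= Num.max (N (zeta j)) c)
  (r0 : forall j, 0 <= r j) (rM0 : r 0%N ^+ 2 = N (M 0%N) ^+ 2)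
  (rS : forall j, r j.+1 ^+ 2 = r j ^+ 2 + N (M j.+1 - M j) ^+ 2).

Let N0 x : 0 <= N x. Proof. exact: sqrtr_ge0. Qed.

(* The inner factor is the scalar taking [xi j.+1] to its difference with its
   projection on the ball of radius [S k]; both divisions yield [0] when the
   denominator vanishes. *)
Definition transform_weight (k j : nat) : R :=
  Num.max (N (xi j.+1) - S k) 0 / N (xi j.+1) / (r j + (S j - S k)).

Lemma r_nd : {homo r : i j / (i <= j)%N >-> i <= j}.
Proof.
apply: homo_leq => [//|? ? ?|i]; first exact: le_trans.
by rewrite -(@ler_pXn2r _ 2) ?nnegrE// rS lerDl sqr_ge0.
Qed.

Lemma normDM_le j : (j < n)%N -> N (M j.+1 - M j) <= r n.
Proof.
move=> jn; apply: le_trans (r_nd jn).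
by rewrite -(@ler_pXn2r _ 2) ?nnegrE// rS lerDr sqr_ge0.
Qed.

Lemma running_max0_le : S 0%N <= c + r n.
Proof.
have -> : S 0%N = Num.max c (N (M 0%N)) by rewrite zeta0.
have -> : N (M 0%N) = r 0%N by apply/eqP; rewrite -(@eqrXn2 _ 2)// rM0.
have r0n : r 0%N <= r n by exact: r_nd.
by rewrite ge_max lerDl r0/= (le_trans r0n)// lerDr.
Qed.

(** The drift [xi j.+1] never exceeds [S j], so only the martingale increment can raise the
    maximum. *)
Lemma running_maxS_le j : (j < n)%N -> S j.+1 <= S j + r n.
Proof.
move=> jn; rewrite /= ge_max lerDl r0/= zetaS//.
apply: (le_trans (dot_norm_triangle B _ _)); rewrite lerD ?normDM_le//.
apply: (le_trans (xi_le jn)).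
by rewrite ge_max (running_max_ge c (N \o zeta)) running_max_gec.
Qed.

(** A crude bound growing with the time index; it serves for integrability only and leaves no trace
    in the final constant. *)
Lemma running_max_le j : (j <= n)%N -> S j <= c + r n *+ j.+1.
Proof.
elim: j => [_|j IH jn]; first exact: running_max0_le.
rewrite (le_trans (running_maxS_le jn))// mulrSr addrA lerD2r.
exact/IH/ltnW.
Qed.

Lemma running_max_growth k : (k <= n)%N -> S n - S k <= 53 * r n +
  8 * \sum_(k <= j < n) transform_weight k j * B (xi j.+1) (M j.+1 - M j).
Proof.
move=> kn; have Sk0 : 0 <= S k by exact: le_trans (running_max_gec _ _ _).
under eq_bigr do rewrite /transform_weight mulrAC.
apply: (@running_max_bound _ (fun j => Num.max (N (zeta j) - S k) 0)
  (fun j => N (M j.+1 - M j)) _ r (fun j => S j - S k)) => //.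
- by apply/max_idPr; rewrite subr_le0; exact: (running_max_ge c (N \o zeta)).
- by rewrite subrr.
- by move=> j; rewrite le_max lexx orbT.
move=> j /andP[kj jn].
(* The drift does not increase the distance to the ball of radius [S k], precisely because
   [c <= S k]. *)
have D_le : Num.max (N (xi j.+1) - S k) 0 <= Num.max (N (zeta j) - S k) 0.
  rewrite ge_max [X in _ && X]le_max lexx orbT andbT.
  have := xi_le jn; have := running_max_gec c (N \o zeta) k; rewrite -/(S k) => cS.
  rewrite !le_max => /orP[h|h]; apply/orP; [left|right]; lra.
have D0 x : 0 <= Num.max (N x - S k) 0 by rewrite le_max lexx orbT.
split.
- exact: rS.
(* From time [k] on, [S j - S k] is the running maximum of the distances: a point inside the ball
   has distance [0] and does not change [S]. *)
- have : S k <= S j by exact: running_max_nd.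
  rewrite -subr_ge0 => Skj.
  have -> : S j.+1 = Num.max (S j) (N (zeta j.+1)) by [].
  case: (leP (N (zeta j.+1)) (S k)) => h.
    have -> : Num.max (N (zeta j.+1) - S k) 0 = 0 by apply/max_idPr; rewrite subr_le0.
    have -> : Num.max (S j) (N (zeta j.+1)) = S j.
      by apply/max_idPl; rewrite (le_trans h)// -subr_ge0.
    by apply/esym/max_idPl.
  have -> : Num.max (N (zeta j.+1) - S k) 0 = N (zeta j.+1) - S k.
    by apply/max_idPl; rewrite subr_ge0 ltW.
  by rewrite addr_maxl.
- rewrite zetaS//; apply: (le_trans (dist_ball_sqr_le B _ _ Sk0)).
  by rewrite 2!lerD2r ler_pXn2r ?nnegrE ?D0.
- apply: (le_trans (dist_ball_dot_le B _ _ Sk0)).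
  by rewrite ler_wpM2r.
Qed.

(** Garsia's argument with [A = 53] and [m k] equal to [8] times the transform started at [k]; hence
    [54 = 53 + 1] and [16 * p = 2 * p * 8]. *)
Lemma pathwise_bound : S n `^ p <= 2 * (2 * (p * (54 * r n + c))) `^ p +
  16 * p * \sum_(k < n.+1) \sum_(k <= j < n)
    powR_incr (p - 1) S k * transform_weight k j * B (xi j.+1) (M j.+1 - M j).
Proof.
have S00 : 0 <= S 0%N by exact: le_trans (running_max_gec _ _ _).
have := @garsia_bound R p (r n) c 53 S (fun k => 8 * \sum_(k <= j < n)
  transform_weight k j * B (xi j.+1) (M j.+1 - M j)) n p1 (r0 n) c0.
rewrite natr1; move=> /(_ _ S00 running_max0_le (@running_max_nd _ c _)).
move=> /(_ _ running_maxS_le running_max_growth) /le_trans; apply => //.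
rewrite lerD2l [X in 2 * p * X <= _](_ : _ = 8 * \sum_(k < n.+1) \sum_(k <= j < n)
    powR_incr (p - 1) S k * transform_weight k j * B (xi j.+1) (M j.+1 - M j)).
  by rewrite mulrA (_ : 2 * p * 8 = 16 * p)//; ring.
rewrite mulr_sumr; apply: eq_bigr => k _.
rewrite mulrCA; congr (_ * _); rewrite mulr_sumr; apply: eq_bigr => j _.
by rewrite mulrA.
Qed.

Lemma transform_weight_ge0 k j : (k <= j)%N -> 0 <= transform_weight k j.
Proof.
move=> kj; rewrite !divr_ge0// ?le_max ?lexx ?orbT// addr_ge0// subr_ge0.
exact: running_max_nd.
Qed.

(** As [N (xi j.+1) <= S j], the distance of [xi j.+1] to the ball of radius [S k] is at most
    [S j - S k], a part of the denominator. The integrand of the transform is therefore bounded by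
    [1]. *)
Lemma transform_weight_norm_le k j : (k <= j < n)%N ->
  transform_weight k j * N (xi j.+1) <= 1.
Proof.
move=> /andP[kj jn].
have Skj : 0 <= S j - S k by rewrite subr_ge0 running_max_nd.
have [Nx|Nx] := eqVneq (N (xi j.+1)) 0; first by rewrite Nx mulr0.
rewrite /transform_weight mulrAC divfK//.
have [U0|U0] := eqVneq (r j + (S j - S k)) 0; first by rewrite U0 invr0 mulr0.
have Up : 0 < r j + (S j - S k) by rewrite lt_def U0 addr_ge0.
rewrite ler_pdivrMr// mul1r; apply: (@le_trans _ _ (S j - S k)); last by rewrite lerDr.
rewrite ge_max Skj andbT lerD2r (le_trans (xi_le jn))//.
by rewrite ge_max (running_max_ge c (N \o zeta)) running_max_gec.
Qed.

(** The left side dominates the terms of the transform up to a constant; the bound shows that it is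
    integrable once the [p]-th power of [r n] is. The dependence on [n] is harmless for that
    purpose. *)
Lemma running_max_powR_le : S n `^ (p - 1) * r n <=
  (2 `^ p + (2 * n.+1%:R) `^ p + 2 `^ p) * (r n `^ p + c `^ p).
Proof.
have p0 : 0 <= p by exact: le_trans p1.
have Sn0 : 0 <= S n by exact: le_trans (running_max_gec _ _ _).
apply: (le_trans (mul_powR_absorb p1 Sn0 (r0 n))).
have rn0 := powR_ge0 (r n) p; have cn0 := powR_ge0 c p.
have n2 : 0 <= 2 * n.+1%:R :> R by rewrite mulr_ge0.
have h2 := powR_ge0 2 p; have hn := powR_ge0 (2 * n.+1%:R) p.
have Sc : S n `^ p <= (2 * c) `^ p + (2 * (r n *+ n.+1)) `^ p.
  apply: (le_trans _ (powRD_le p0 c0 _)); last by rewrite mulrn_wge0.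
  by rewrite ge0_ler_powR ?nnegrE ?addr_ge0 ?mulrn_wge0// running_max_le.
have S0 := powR_ge0 (S n) p.
move: Sc; rewrite -(mulr_natl (r n)) mulrA.
rewrite (@powRM _ 2 c)// (@powRM _ _ (r n))// (@powRM _ 2 (r n))// => Sc.
have h1 : 0 <= (2 * n.+1%:R) `^ p * c `^ p by exact: mulr_ge0.
have h3 : 0 <= 2 `^ p * c `^ p by exact: mulr_ge0.
have h4 : 0 <= 2 `^ p * r n `^ p by exact: mulr_ge0.
have h5 : 0 <= (2 * n.+1%:R) `^ p * r n `^ p by exact: mulr_ge0.
move: (2 `^ p) (_ `^ p) (c `^ p) (r n `^ p) (S n `^ p) h1 h3 h4 h5 Sc.
by move=> a b cc rr ss; lra.
Qed.

End pathwise.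

(** * Measurability, integrability and the theorem *)

Section measurability.
Context (disp : measure_display) (T : measurableType disp) (R : realType).

(** On nonnegative reals the inverse is the power of exponent [-1], also at [0], where both are
    [0]. *)
Lemma measurable_ge0_invr (f : T -> R) : (forall w, 0 <= f w) ->
  measurable_fun setT f -> measurable_fun setT (fun w => (f w)^-1).
Proof.
move=> f0 mf; rewrite (_ : (fun w => _) = (@powR R ^~ (-1)) \o f); last first.
  by apply/funext => w /=; rewrite powR_inv1.
exact: measurableT_comp.
Qed.

Lemma measurable_sqrtr (f : T -> R) :
  measurable_fun setT f -> measurable_fun setT (fun w => Num.sqrt (f w)).
Proof.
move=> mf; apply: measurableT_comp => //.
by apply: continuous_measurable_fun; exact: sqrt_continuous.
Qed.

Lemma measurable_bigmaxr (I : Type) (s : seq I) (f : I -> T -> R) :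
  (forall i, measurable_fun setT (f i)) ->
  measurable_fun setT (fun w => \big[Num.max/0]_(i <- s) f i w).
Proof.
move=> mf; elim: s => [|i s IH].
  by under eq_fun do rewrite big_nil; exact: measurable_cst.
by under eq_fun do rewrite big_cons; exact: measurable_maxr.
Qed.

Lemma measurable_running_max (c : R) (x : nat -> T -> R) n :
  (forall j, (j <= n)%N -> measurable_fun setT (x j)) ->
  measurable_fun setT (fun w => running_max c (x ^~ w) n).
Proof.
elim: n => [|n IH] mx /=; first by apply: measurable_maxr => //; exact: mx.
apply: measurable_maxr; last exact: mx.
by apply: IH => j jn; apply: mx; exact: leqW.
Qed.

Lemma measurable_powR_incr (q : R) (S : nat -> T -> R) k :
  (forall j, (j <= k)%N -> measurable_fun setT (S j)) ->
  measurable_fun setT (fun w => powR_incr q (S ^~ w) k).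
Proof.
case: k => [|k] mS /=.
  exact: (measurableT_comp (measurable_powR q) (mS 0%N _)).
apply: measurable_funB; first exact: (measurableT_comp (measurable_powR q) (mS k.+1 _)).
exact: (measurableT_comp (measurable_powR q) (mS k _)).
Qed.

Context (d : nat) (B : {dot 'rV[R]_d for idfun}).
Let N (x : 'rV[R]_d) : R := Num.sqrt (B x x).
Let vmeas (X : T -> 'rV[R]_d) := forall i, measurable_fun setT (fun w => X w ord0 i).

Lemma measurable_dot_norm (X : T -> 'rV[R]_d) : vmeas X ->
  measurable_fun setT (fun w => N (X w)).
Proof.
move=> mX; apply: measurable_sqrtr; under eq_fun do rewrite dot_sum.
do 2 apply: measurable_sum => ?.
apply: measurable_funM => //.
by apply: measurable_funM => //; exact: measurable_cst.
Qed.

Lemma measurable_quadvar (M : nat -> T -> 'rV[R]_d) n :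
  (forall j, (j <= n)%N -> vmeas (M j)) ->
  measurable_fun setT (quadvar N M n).
Proof.
elim: n => [|n IH] mM.
  rewrite /quadvar; under eq_fun do rewrite big_geq// add0r.
  by apply: measurable_funX; apply: measurable_dot_norm; exact: mM.
have -> : quadvar N M n.+1 = (fun w => quadvar N M n w + N (M n.+1 w - M n w) ^+ 2).
  by apply/funext => w; rewrite /quadvar big_nat_recr//= addrAC.
apply: measurable_funD; first by apply: IH => j jn; apply: mM; exact: leqW.
apply: measurable_funX; apply: measurable_dot_norm => i.
by under eq_fun do rewrite !mxE; apply: measurable_funB; exact: mM.
Qed.

Lemma measurable_transform_weight (c : R) (zeta xi : nat -> T -> 'rV[R]_d)
    (r : nat -> T -> R) (k j : nat) : (k <= j)%N ->
  (forall i, (i <= j)%N -> vmeas (zeta i)) -> vmeas (xi j.+1) ->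
  (forall w, 0 <= r j w) -> measurable_fun setT (r j) ->
  measurable_fun setT (fun w =>
    transform_weight B c (zeta ^~ w) (xi ^~ w) (r ^~ w) k j).
Proof.
move=> kj mzeta mxi r0 mr; rewrite /transform_weight.
have mS i : (i <= j)%N -> measurable_fun setT (fun w =>
    running_max c ((fun x => N x) \o (zeta ^~ w)) i).
  move=> ij; apply: measurable_running_max => l li.
  by apply: measurable_dot_norm; apply: mzeta; exact: leq_trans ij.
apply: measurable_funM; first apply: measurable_funM.
- apply: measurable_maxr => //; apply: measurable_funB; last exact: mS.
  exact: measurable_dot_norm.
- apply: measurable_ge0_invr; last exact: measurable_dot_norm.
  by move=> w; exact: sqrtr_ge0.
- apply: measurable_ge0_invr.
    by move=> w; rewrite addr_ge0// subr_ge0 running_max_nd.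
  by apply: measurable_funD => //; apply: measurable_funB; exact: mS.
Qed.

End measurability.

(** Domination is asked almost everywhere only, to fit a recursion for [zeta] that holds almost
    surely. *)
Lemma ae_le_integrable d (T : measurableType d) (R : realType)
    (mu : {measure set T -> \bar R}) (f g : T -> \bar R) :
  measurable_fun setT f -> mu.-integrable setT g ->
  {ae mu, forall w, (`|f w| <= `|g w|)%E} -> mu.-integrable setT f.
Proof.
move=> mf /integrableP[mg ig] fg; apply/integrableP; split => //.
apply: le_lt_trans ig; apply: ae_ge0_le_integral => //.
- exact: measurableT_comp.
- exact: measurableT_comp.
- by apply: filterS fg => w + _.
Qed.

Section centered.
Context d (T : measurableType d) (R : realType) (mu : {measure set T -> \bar R}).

(** Integrability is bundled with the zero integral because additivity of the integral calls for it
    at each finite sum. *)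
Definition centered (f : T -> R) : Prop :=
  mu.-integrable setT (EFin \o f) /\ (\int[mu]_w (f w)%:E = 0)%E.

Lemma centered_sum (I : eqType) (s : seq I) (f : I -> T -> R) :
  (forall i, i \in s -> centered (f i)) ->
  centered (fun w => \sum_(i <- s) f i w).
Proof.
elim: s => [_|i s IH fs].
  rewrite (_ : (fun w => _) = cst 0); last by apply/funext => w; rewrite big_nil.
  by split; [exact: integrable0|rewrite integral0].
have [iI I0] := IH (fun j js => fs j (@mem_behead _ (i :: s) j js)).
have [ii i0] := fs i (mem_head i s).
have E : EFin \o (fun w => \sum_(j <- i :: s) f j w) =
    (fun w => (f i w)%:E + (\sum_(j <- s) f j w)%:E)%E.
  by apply/funext => w /=; rewrite big_cons EFinD.
split; first by rewrite E; exact: integrableD.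
under eq_integral do rewrite big_cons EFinD.
by rewrite integralD// i0 I0 adde0.
Qed.

End centered.

Lemma measurable_wrtS (disp : measure_display) (T : measurableType disp)
    (R : realType) (G H : set (set T)) (X : T -> R) :
  G `<=` H -> measurable_wrt G X -> measurable_wrt H X.
Proof.
move=> GH mX mT Y mY.
exact: (sub_sigma_algebra2 GH (mX measurableT Y mY)).
Qed.

Section quadvar.
Context (disp : measure_display) (T : measurableType disp) (R : realType)
  (d : nat) (N : 'rV[R]_d -> R) (M : nat -> T -> 'rV[R]_d).

Lemma quadvar_ge0 n w : 0 <= quadvar N M n w.
Proof. by rewrite addr_ge0 ?sqr_ge0// sumr_ge0// => i _; exact: sqr_ge0. Qed.

Lemma quadvarS n w :
  quadvar N M n.+1 w = quadvar N M n w + N (M n.+1 w - M n w) ^+ 2.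
Proof. by rewrite /quadvar big_nat_recr//= addrAC. Qed.

End quadvar.

(** * Integrability and centering of the martingale transform *)

Section transform.
Context (disp : measure_display) (T : measurableType disp) (R : realType)
  (P : probability T R) (F : nat -> set (set T)) (hF : is_filtration F)
  (d : nat) (B : {dot 'rV[R]_d for idfun}) (p c : R) (n : nat)
  (zeta xi M : nat -> T -> 'rV[R]_d).
Hypotheses (p1 : 1 <= p) (c0 : 0 <= c).
Hypotheses (mzeta : adapted F zeta) (mxi : previsible F xi) (mM : martingale P F M).
Let N (x : 'rV[R]_d) : R := Num.sqrt (B x x).
Hypotheses (ae0 : {ae P, forall w, M 0%N w = zeta 0%N w})
  (aeS : forall n, {ae P, forall w,
        zeta n.+1 w = xi n.+1 w + (M n.+1 w - M n w) /\
        N (xi n.+1 w) <= Num.max (N (zeta n w)) c}).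
Let r j w : R := Num.sqrt (quadvar N M j w).
Let S w := running_max c (N \o (zeta ^~ w)).
Hypothesis ir : P.-integrable setT (fun w => (r n w `^ p)%:E).

Let weight k j w : R := powR_incr (p - 1) (S w) k *
  transform_weight B c (zeta ^~ w) (xi ^~ w) (r ^~ w) k j.

Let good w := [/\ M 0%N w = zeta 0%N w,
  forall j, (j < n)%N -> zeta j.+1 w = xi j.+1 w + (M j.+1 w - M j w),
  forall j, (j < n)%N -> N (xi j.+1 w) <= Num.max (N (zeta j w)) c,
  r 0%N w ^+ 2 = N (M 0%N w) ^+ 2 &
  forall j, r j.+1 w ^+ 2 = r j w ^+ 2 + N (M j.+1 w - M j w) ^+ 2].

(** Countably many almost sure relations hold simultaneously; the two relations on [r] hold
    everywhere. *)
Let ae_good : {ae P, forall w, good w}.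
Proof.
have /ae_foralln aeS' := aeS.
near=> w; split.
- by near: w.
- move=> j _; have : forall i, zeta i.+1 w = xi i.+1 w + (M i.+1 w - M i w) /\
    N (xi i.+1 w) <= Num.max (N (zeta i w)) c by near: w.
  by move=> /(_ j)[].
- move=> j _; have : forall i, zeta i.+1 w = xi i.+1 w + (M i.+1 w - M i w) /\
    N (xi i.+1 w) <= Num.max (N (zeta i w)) c by near: w.
  by move=> /(_ j)[].
- by rewrite sqr_sqrtr ?quadvar_ge0// /quadvar big_geq// add0r.
- move=> j; rewrite /r [LHS]sqr_sqrtr ?quadvar_ge0// quadvarS.
  by congr (_ + _); rewrite sqr_sqrtr ?quadvar_ge0.
Unshelve. all: by end_near. Qed.

Let measurable_F j A : F j A -> measurable A.
Proof. by case: hF => _ + _; apply. Qed.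

(** The weight involves [zeta] and [M] up to time [j] and, by previsibility, the [F j]-measurable
    [xi j.+1]: it is known before the increment it multiplies. *)
Let weight_measurable k j : (k <= j)%N -> measurable_wrt (F j) (weight k j).
Proof.
move=> kj; case: hF => _ _ ndF.
have mz i l : (i <= j)%N -> measurable_wrt (F j) (fun w => zeta i w ord0 l).
  by move=> ij; exact: (measurable_wrtS (ndF _ _ ij) (@mzeta i l)).
have mMj i l : (i <= j)%N -> measurable_wrt (F j) (fun w => M i w ord0 l).
  by case: mM => aM _ _ ij; exact: (measurable_wrtS (ndF _ _ ij) (aM i l)).
apply: measurable_funM.
  apply: (@measurable_powR_incr _ (g_sigma_algebraType (F j)) R (p - 1)
    (fun i w => S w i)) => i ik.
  apply: measurable_running_max => l li; apply: measurable_dot_norm => m.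
  by apply: mz; exact: leq_trans (leq_trans li ik) kj.
apply: (@measurable_transform_weight _ (g_sigma_algebraType (F j)) R d B c
  zeta xi r k j kj).
- by move=> i ij l; exact: mz.
- by move=> l; exact: mxi.
- by move=> w; exact: sqrtr_ge0.
- apply: measurable_sqrtr.
  apply: (@measurable_quadvar _ (g_sigma_algebraType (F j))) => i ij l.
  exact: mMj.
Qed.

Let rv_meas j : measurable_fun setT (r j).
Proof.
apply: measurable_sqrtr; apply: measurable_quadvar => i _ l.
by case: mM => _ iM _; apply/measurable_EFinP; exact: measurable_int (iM i l).
Qed.

Let powR_incr_le w k : (k <= n)%N -> powR_incr (p - 1) (S w) k <= S w n `^ (p - 1).
Proof.
move=> kn; have q0 : 0 <= p - 1 by rewrite subr_ge0.
have S0 j : 0 <= S w j by exact: le_trans (running_max_gec _ _ _).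
apply: (@le_trans _ _ (S w k `^ (p - 1))).
  by case: k {kn} => [//|k] /=; rewrite gerBl powR_ge0.
by rewrite ge0_ler_powR ?nnegrE// running_max_nd.
Qed.

(** Almost surely the power increment is at most the [(p-1)]-th power of [S n], the weighted
    coordinate of [xi] at most [K], and the coordinate of the martingale increment at most
    [K * r n]. *)
Lemma transform_term_integrable k j i l (b : R) : (k <= j < n)%N ->
  P.-integrable setT (fun w => (weight k j w * xi j.+1 w ord0 i * b *
    (M j.+1 w ord0 l - M j w ord0 l))%:E).
Proof.
move=> kjn; have /andP[kj jn] := kjn; case: (mM) => aM iM eM.
have [K [K0 coordK]] := dot_coord_le B.
pose C := K * `|b| * K * (2 `^ p + (2 * n.+1%:R) `^ p + 2 `^ p).
have mDM m : measurable_fun setT (fun w => M m w ord0 l).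
  by apply/measurable_EFinP; exact: measurable_int (iM m l).
apply: (@ae_le_integrable _ _ _ P _ (fun w => C%:E * ((r n w `^ p)%:E + (c `^ p)%:E))%E).
- apply/measurable_EFinP; apply: measurable_funM; last exact: measurable_funB.
  apply: measurable_funM; last exact: measurable_cst.
  case: hF => sF Fm _.
  apply: measurable_funM; apply: (measurable_wrtW (sF j) (Fm j)).
    exact: weight_measurable.
  exact: mxi.
- apply: integrableZl => //; apply: integrableD => //.
  exact: finite_measure_integrable_cst.
apply: filterS ae_good => w [M0 zS xS rM0 rS].
have r0 m : 0 <= r m w by exact: sqrtr_ge0.
have Sw0 : 0 <= S w 0%N by exact: le_trans (running_max_gec _ _ _).
rewrite -EFinD -EFinM !abse_EFin lee_fin [leRHS]ger0_norm; last first.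
  by rewrite !(mulr_ge0, addr_ge0, powR_ge0).
have DM : `|M j.+1 w ord0 l - M j w ord0 l| <= K * r n w.
  have := coordK (M j.+1 w - M j w) l; rewrite !mxE => /le_trans; apply.
  by rewrite ler_wpM2l//; exact: (@normDM_le _ _ B (M ^~ w) (r ^~ w) n r0 rS).
pose tw := transform_weight B c (zeta ^~ w) (xi ^~ w) (r ^~ w) k j.
have tw0 : 0 <= tw by exact: transform_weight_ge0.
have tx : tw * `|xi j.+1 w ord0 i| <= K.
  apply: (@le_trans _ _ (K * (tw * N (xi j.+1 w)))).
    by rewrite mulrCA ler_wpM2l// coordK.
  rewrite ler_piMr//; exact: (@transform_weight_norm_le _ _ B c (zeta ^~ w)
    (xi ^~ w) (r ^~ w) n xS r0).
have q0 : 0 <= p - 1 by rewrite subr_ge0.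
have pi0 : 0 <= powR_incr (p - 1) (S w) k.
  by apply: powR_incr_ge0 => //; exact: running_max_nd.
rewrite /weight -/tw 4!normrM (ger0_norm tw0) (ger0_norm pi0).
have Sr := @running_max_powR_le _ _ B p c (zeta ^~ w) (xi ^~ w) (M ^~ w)
  (r ^~ w) n p1 c0 M0 zS xS r0 rM0 rS.
apply: (@le_trans _ _ (K * `|b| * K * (S w n `^ (p - 1) * r n w))); last first.
  by rewrite /C -!mulrA !ler_wpM2l.
have -> : K * `|b| * K * (S w n `^ (p - 1) * r n w) =
   S w n `^ (p - 1) * K * `|b| * (K * r n w) by ring.
apply: ler_pM => //; first by rewrite 3?mulr_ge0.
rewrite ler_wpM2r// -mulrA; apply: ler_pM => //; first by rewrite mulr_ge0.
by rewrite powR_incr_le// (leq_trans kj)// ltnW.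
Qed.

(** An increment with zero integral over every set of [F j] is multiplied by an [F j]-measurable
    factor. *)
Lemma integral_transform_term k j i l (b : R) : (k <= j < n)%N ->
  (\int[P]_w (weight k j w * xi j.+1 w ord0 i * b *
    (M j.+1 w ord0 l - M j w ord0 l))%:E = 0)%E.
Proof.
move=> kjn; have /andP[kj jn] := kjn.
case: (mM) => aM iM eM; case: hF => sF Fm _.
have [_ _ eA] := eM j l.
pose D w := M j.+1 w ord0 l - M j w ord0 l.
have iD : P.-integrable setT (EFin \o D).
  rewrite (_ : EFin \o D = (fun w => (M j.+1 w ord0 l)%:E - (M j w ord0 l)%:E)%E).
    exact: integrableB.
  by apply/funext => w; rewrite -EFinB.
have D0 A : F j A -> (\int[P]_(w in A) (D w)%:E = 0)%E.
  move=> FA; under eq_integral do rewrite EFinB.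
  have mA := measurable_F FA.
  have iA m : P.-integrable A (fun w => (M m w ord0 l)%:E).
    by apply: (integrableS measurableT).
  rewrite integralB//= eA// subee//.
  exact: integrable_fin_num.
apply: (integral_measurable_wrtM_eq0 (sF j) (Fm j) iD D0).
- apply: measurable_funM; last exact: measurable_cst.
  by apply: measurable_funM; [exact: weight_measurable|exact: mxi].
- exact: transform_term_integrable.
Qed.

Let Z w := \sum_(k < n.+1) \sum_(k <= j < n)
  weight k j w * B (xi j.+1 w) (M j.+1 w - M j w).

Let centered_Z : centered P Z.
Proof.
apply: centered_sum => k _; apply: centered_sum => j; rewrite mem_index_iota => kj.
(* Expanding the inner product through its Gram matrix reduces the claim to scalar martingale
   increments. *)
rewrite (_ : (fun w => _) = fun w => \sum_i \sum_l
    weight k j w * xi j.+1 w ord0 i * B (delta_mx 0 i) (delta_mx 0 l) *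
    (M j.+1 w ord0 l - M j w ord0 l)); last first.
  apply/funext => w; rewrite dot_sum mulr_sumr; apply: eq_bigr => i _.
  by rewrite mulr_sumr; apply: eq_bigr => l _; rewrite !mxE !mulrA.
apply: centered_sum => i _; apply: centered_sum => l _.
by split; [exact: transform_term_integrable|exact: integral_transform_term].
Qed.

Lemma maximal_inequality_integrable :
  (\int[P]_w (\big[Num.max/0]_(k < n.+1) (N (zeta k w) `^ p))%:E <=
   (2 * (216 * p) `^ p)%:E *
     (\int[P]_w (r n w `^ p)%:E + (c `^ p)%:E))%E.
Proof.
have [iZ Z0] := centered_Z; have p0 : 0 <= p by exact: le_trans p1.
set f := fun w => \big[Num.max/0]_(k < n.+1) (N (zeta k w) `^ p).
set kappa := 2 * (216 * p) `^ p.
pose g w := (kappa%:E * ((r n w `^ p)%:E + (c `^ p)%:E) + (16 * p)%:E * (Z w)%:E)%E.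
have ig1 : P.-integrable setT (fun w => (r n w `^ p)%:E + (c `^ p)%:E)%E.
  by apply: integrableD => //; exact: finite_measure_integrable_cst.
have ig : P.-integrable setT g.
  by apply: integrableD => //; exact: integrableZl.
have Ig : (\int[P]_w g w = kappa%:E * (\int[P]_w (r n w `^ p)%:E + (c `^ p)%:E))%E.
  rewrite integralD//; [|exact: integrableZl|exact: integrableZl].
  rewrite !integralZl// Z0 mule0 adde0 integralD//.
    by rewrite integral_cst//= probability_setT mule1.
  exact: finite_measure_integrable_cst.
have mz k i : measurable_fun setT (fun w => zeta k w ord0 i).
  by case: hF => sF Fm _; exact: (measurable_wrtW (sF k) (Fm k) (@mzeta k i)).
have mf : measurable_fun setT f.
  apply: measurable_bigmaxr => k; apply: (measurableT_comp (measurable_powR p)).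
  by apply: measurable_dot_norm => i; exact: mz.
have f0 w : 0 <= f w.
  rewrite /f; elim/big_ind: _ => [//|x y x0 _|k _]; first by rewrite le_max x0.
  exact: powR_ge0.
have fg : {ae P, forall w, ((f w)%:E <= g w)%E}.
  apply: filterS ae_good => w [M0 zS xS rM0 rS].
  have r0 m : 0 <= r m w by exact: sqrtr_ge0.
  have Sw0 j : 0 <= S w j by exact: le_trans (running_max_gec _ _ _).
  rewrite /g -!(EFinM, EFinD) lee_fin.
  apply: (@le_trans _ _ (S w n `^ p)).
    apply: bigmax_le => [|k _]; first exact: powR_ge0.
    rewrite ge0_ler_powR ?nnegrE ?sqrtr_ge0//.
    rewrite (le_trans (running_max_ge c (N \o (zeta ^~ w)) k))//.
    by rewrite running_max_nd// -ltnS.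
  apply: (le_trans (@pathwise_bound _ _ B p c (zeta ^~ w) (xi ^~ w) (M ^~ w)
    (r ^~ w) n p1 c0 M0 zS xS r0 rM0 rS)).
  rewrite lerD2r /kappa -mulrA ler_wpM2l//.
  (* Splitting the power of the sum doubles both terms, to [216 * p * r n] and [4 * p * c]; the
     latter is enlarged to [216 * p * c]. *)
  rewrite (_ : 2 * (p * (54 * r n w + c)) = 108 * p * r n w + 2 * p * c); last by ring.
  apply: (le_trans (powRD_le p0 _ _)); [by rewrite !mulr_ge0|by rewrite !mulr_ge0|].
  rewrite mulrDr -!powRM ?mulr_ge0//.
  rewrite (_ : 2 * (108 * p * r n w) = 216 * p * r n w); last by ring.
  rewrite lerD2l ge0_ler_powR ?nnegrE ?mulr_ge0//.
  have : 0 <= p * c by rewrite mulr_ge0.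
  lra.
rewrite -Ig.
(* [g] may be negative on a null set, so the comparison of nonnegative integrands passes through its
   positive part, almost everywhere equal to [g]. *)
apply: (@le_trans _ _ (\int[P]_w (Order.max (g w) 0))%E).
  apply: ae_ge0_le_integral => //.
  - by move=> w _; rewrite lee_fin; exact: f0.
  - exact/measurable_EFinP.
  - by move=> w _; rewrite le_max lexx orbT.
  - by apply: measurable_maxe => //; exact: measurable_int ig.
  - by apply: filterS fg => w h _; rewrite le_max h.
rewrite le_eqVlt; apply/orP; left; apply/eqP; apply: ae_eq_integral => //.
- by apply: measurable_maxe => //; exact: measurable_int ig.
- exact: measurable_int ig.
- apply: filterS fg => w h _; apply/max_idPl; apply: le_trans h.
  by rewrite lee_fin; exact: f0.
Qed.

End transform.

(** * Reduction to an integrable power of the bracket *)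

Theorem theorem5p1 (R : realType) (p : R) (hp : 1 <= p) :
  exists kappa : R, 0 < kappa /\
  forall (disp : measure_display) (T : measurableType disp)
    (P : probability T R) (F : nat -> set (set T)) (hF : is_filtration F)
    (d : nat) (N : 'rV[R]_d -> R) (hN : is_hilbert_norm N)
    (zeta xi M : nat -> T -> 'rV[R]_d) (c : R),
    adapted F zeta ->
    previsible F xi ->
    martingale P F M ->
    {ae P, forall w, M 0%N w = zeta 0%N w} ->
    0 <= c ->
    (forall n, {ae P, forall w,
        zeta n.+1 w = xi n.+1 w + (M n.+1 w - M n w) /\
        N (xi n.+1 w) <= Num.max (N (zeta n w)) c}) ->
    forall n,
      ('E_P[fun w => (\big[Num.max/0]_(k < n.+1) (N (zeta k w) `^ p))%R]
       <= kappa%:E *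
          ('E_P[fun w => (quadvar N M n w `^ (p / 2))%R] + (c `^ p)%:E))%E.
Proof.
have p0 : 0 < p by exact: lt_le_trans hp.
exists (2 * (216 * p) `^ p); split; first by rewrite mulr_gt0// powR_gt0// mulr_gt0.
move=> disp T P F hF d N [B NE] zeta xi M c mzeta mxi mM ae0 c0 aeS n.
have {NE} EN : N = fun x => Num.sqrt (B x x) by apply/funext.
subst N; set N := fun x : 'rV[R]_d => _.
have rE w : quadvar N M n w `^ (p / 2) = Num.sqrt (quadvar N M n w) `^ p.
  by rewrite mulrC powRrM powR12_sqrt ?quadvar_ge0.
rewrite unlock; under [X in (_ <= _ * (X + _))%E]eq_integral do rewrite rE.
have mr : measurable_fun setT (fun w => (Num.sqrt (quadvar N M n w) `^ p)%:E).
  apply/measurable_EFinP; apply: (measurableT_comp (measurable_powR p)).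
  apply: measurable_sqrtr; apply: measurable_quadvar => i _ l.
  by case: mM => _ iM _; apply/measurable_EFinP; exact: measurable_int (iM i l).
set I := (X in (_ <= _ * (X + _))%E).
(* If the expectation on the right is infinite, so is the right-hand side, since the constant is
   positive; otherwise the integrable case applies. *)
have [Ioo|Ioo] := eqVneq I +oo%E.
  rewrite Ioo addye// gt0_muley ?leey// lte_fin mulr_gt0// powR_gt0//.
  by rewrite mulr_gt0.
apply: (maximal_inequality_integrable hF) => //.
apply/integrableP; split => //.
under eq_integral do rewrite gee0_abs ?lee_fin ?powR_ge0//.
by rewrite ltey.
Qed.
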